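(* Let $\Gamma$ be a totally ordered set, let $(A_\gamma)_{\gamma\in\Gamma}$ be a family of archimedean ordered abelian groups, and let $G$ be a Hahn group with skeleton $[\Gamma;\{A_\gamma:\gamma\in\Gamma\}]$, ordered lexicographically, with canonical valuation $v$. For $\gamma\in\Gamma$ let $C_\gamma=\{x\in G: v(x)\ge\gamma\}$ be the principal convex subgroup of $G$ associated to $\gamma$. Let $\tau$ be an automorphism of the ordered set $\Gamma$. Then $\tau$ lifts to an order preserving automorphism $\sigma$ of $G$ if and only if for all $\gamma\in\Gamma$ there is an isomorphism $\sigma_\gamma\colon C_\gamma\to C_{\tau(\gamma)}$ such that, for all $\gamma,\delta\in\Gamma$, $$\gamma>\delta\ \Longrightarrow\ \sigma_\delta|_{C_\gamma}=\sigma_\gamma .$$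
   Context: For $a=(a_\gamma)\in\prod_{\gamma\in\Gamma}A_\gamma$ let $\operatorname{supp}(a)=\{\gamma: a_\gamma\ne 0\}$. The Hahn sum $\coprod_{\Gamma}A_\gamma$ is the subgroup of elements with finite support, and the Hahn product $\mathbf{H}_{\Gamma}A_\gamma$ is the subgroup of elements with well ordered support. A Hahn group with skeleton $[\Gamma;\{A_\gamma:\gamma\in\Gamma\}]$ is a group $G$ with $\coprod_\Gamma A_\gamma\le G\le \mathbf{H}_\Gamma A_\gamma$. The canonical valuation is $v(g)=\min\operatorname{supp}(g)$ for $g\neq0$ and $v(0)=\infty$, where $\infty>\gamma$ for all $\gamma\in\Gamma$. The lexicographic order on $G$ is defined by $g>0$ iff $g\ne0$ and $g_{v(g)}>0$ in $A_{v(g)}$. An automorphism $\sigma$ of $G$ is order preserving if $g>0$ implies $\sigma(g)>0$. An automorphism $\tau$ of the ordered set $\Gamma$ lifts to an automorphism $\sigma$ of $G$ if $\sigma$ induces $\tau$ on $\Gamma$, i.e. $v(\sigma(g))=\tau(v(g))$ for all $0\neq g\in G$.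
   Formalization: The isomorphisms σ_γ from C_γ to C_{τ(γ)} are taken to be order preserving; for mere group isomorphisms the equivalence fails (Γ=ℤ, τ the shift, components alternating between ℤ+ℤ√2 and ℤ+ℤ√3, G the Hahn sum). *)

(* Defs.v *)
From HB Require Import structures.
From mathcomp Require Import all_boot all_order all_algebra.
From mathcomp Require Import all_classical wochoice.

Set Implicit Arguments.
Unset Strict Implicit.
Unset Printing Implicit Defensive.

Import Order.TTheory GRing.Theory Num.Theory.
Local Open Scope classical_set_scope.
Local Open Scope ring_scope.

(* [porderZmodType] provides a partial order and an addition related by no
   axiom. *)
Definition ordered_group (R : porderZmodType) :=
  total (<=%R : rel R) /\ (forall z x y : R, x <= y -> z + x <= z + y).

Definition archimedean_ordered_group (R : porderZmodType) :=
  ordered_group R /\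
  (forall x y : R, 0 < x -> exists n : nat, y < x *+ n).

(* The full product of the family [A], under its own name so that it does not
   compete with the library's instances on function types. *)
Definition fam_prod (I : Type) (A : I -> zmodType) := forall i, A i.

HB.instance Definition _ (I : Type) (A : I -> zmodType) :=
  Choice.copy (fam_prod A) (forall i, A i).

Section FamProdZmodule.
Variables (I : Type) (A : I -> zmodType).

Definition fam_zero : fam_prod A := fun=> 0.
Definition fam_opp (f : fam_prod A) : fam_prod A := fun i => - f i.
Definition fam_add (f g : fam_prod A) : fam_prod A := fun i => f i + g i.

Fact fam_addA : associative fam_add.
Proof. by move=> f g h; apply: functional_extensionality_dep => i; exact: addrA. Qed.

Fact fam_addC : commutative fam_add.
Proof. by move=> f g; apply: functional_extensionality_dep => i; exact: addrC. Qed.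

Fact fam_add0 : left_id fam_zero fam_add.
Proof. by move=> f; apply: functional_extensionality_dep => i; exact: add0r. Qed.

Fact fam_addN : left_inverse fam_zero fam_opp fam_add.
Proof. by move=> f; apply: functional_extensionality_dep => i; exact: addNr. Qed.

HB.instance Definition _ := GRing.isZmodule.Build (fam_prod A)
  fam_addA fam_addC fam_add0 fam_addN.

End FamProdZmodule.

Section HahnGroups.
Context {d : Order.disp_t} {Gamma : orderType d} {A : Gamma -> porderZmodType}.
Local Notation H := (fam_prod A).
Implicit Types (g : H) (G C D : set H) (f : H -> H) (gamma : Gamma).

Definition supp g : set Gamma := [set gamma | g gamma <> 0].

Definition hahn_sum : set H := [set g | finite_set (supp g)].

Definition hahn_product : set H := [set g | wo_chain <=%O [in supp g]].

Definition is_hahn_group G :=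
  [/\ zmod_closed [in G], hahn_sum `<=` G & G `<=` hahn_product].

(* The value set [Gamma] extended by infinity is [option Gamma], with [None] as
   infinity.  On [hahn_product], [hval g] is [None] exactly when [g = 0]; it is
   a junk value only for elements whose support has no minimum. *)
Definition hval g : option Gamma :=
  xget None (Some @` (supp g `&` lbound (supp g))).

Definition val_le (u v : option Gamma) : bool :=
  match u, v with
  | _, None => true
  | None, Some _ => false
  | Some a, Some b => (a <= b)%O
  end.

Definition hpos g : Prop :=
  g <> 0 /\ (if hval g is Some gamma then 0 < g gamma else False).

Definition principal_convex G gamma : set H :=
  [set x | G x /\ val_le (Some gamma) (hval x)].

(* Maps between subgroups are represented by maps of the ambient product, of
   which only the values on the source subgroup matter. *)
Definition ordered_iso C D f :=
  [/\ set_bij C D f,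
      {in C &, {morph f : x y / x + y}}
    & {in C, forall x, hpos x -> hpos (f x)}].

Definition order_preserving_aut G f := ordered_iso G G f.

Definition lifts_to G (tau : Gamma -> Gamma) f :=
  forall g, G g -> g <> 0 -> hval (f g) = omap tau (hval g).

End HahnGroups.

Definition order_automorphism (d : Order.disp_t) (Gamma : orderType d)
    (tau : Gamma -> Gamma) :=
  bijective tau /\ {mono tau : x y / (x <= y)%O}.

(* Main.v *)
Require Import Defs.
From mathcomp Require Import all_boot all_order all_algebra.
From mathcomp Require Import all_classical wochoice.

(** The groups [C_c] of elements of value at least [c] form a chain, decreasing
    in [c], whose union is [G] as soon as [Gamma] is nonempty: a nonzero [x]
    belongs to [C_(v x)].  An automorphism [sigma] which induces [tau] on the
    values maps [C_c] onto [C_(tau c)], since [v x >= c] is equivalent to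
    [tau (v x) >= tau c]; so all [sigma_ c] can be taken equal to [sigma].

    Conversely, compatible isomorphisms [sigma_ c] agree on overlaps and glue to
    a map on the union, namely [x |-> sigma_ (v x) x] ([glue], [glueE]).  Any two
    elements lie in a common [C_c] ([principal_convex_cover2]), so additivity,
    injectivity and positivity of the glued map are inherited from one
    [sigma_ c], and surjectivity holds because the [C_(tau c)] cover [G] as well.
    The one point with some content is that the glued map induces exactly [tau]
    ([local_iso_hval]): if [v x = c] but [sigma_ c x] had value [tau c'] with
    [c' > c], it would already be the image of an element of [C_c'], and by
    injectivity [x] itself would have value at least [c'].  If [Gamma] is empty,
    [G] is trivial. *)

Section HahnGroupAutomorphisms.
Set Implicit Arguments.
Unset Strict Implicit.
Import Order.TTheory GRing.Theory.
Local Open Scope classical_set_scope.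
Local Open Scope ring_scope.

Context {d : Order.disp_t} {Gamma : orderType d} {A : Gamma -> porderZmodType}.
Implicit Types (x y g : fam_prod A) (C D : set (fam_prod A)) (a b c : Gamma).

(** * The valuation and the chain of principal convex subgroups *)

Lemma hval0 : hval (0 : fam_prod A) = None.
Proof. by apply: xgetPN => v [a [/(_ erefl)]]. Qed.

Lemma hval_min g a :
  g a <> 0 -> (forall b, g b <> 0 -> (a <= b)%O) -> hval g = Some a.
Proof.
move=> ga lba; apply: xget_unique; first by exists a.
move=> _ [b [gb lbb] <-]; congr Some; apply/eqP.
by rewrite eq_le lba // lbb.
Qed.

Lemma hahn_product_min g : hahn_product g -> g <> 0 ->
  exists a, [/\ hval g = Some a, g a <> 0 & forall b, g b <> 0 -> (a <= b)%O].
Proof.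
move=> wog g0; have [a ga] : exists a, g a <> 0.
  apply: contrapT => /forallNP g0'; apply: g0.
  by apply: functional_extensionality_dep => a; apply: contrapT (g0' a).
have [|m [[/set_mem gm lbm] _]] := wog [in supp g] (fun _ => id).
  by exists a; apply: mem_set.
have {}lbm b : g b <> 0 -> (m <= b)%O by move=> gb; apply/lbm/mem_set.
by exists m; split=> //; exact: hval_min.
Qed.

Context {G : set (fam_prod A)} (G_hahn : is_hahn_group G).

Let G0 : G 0.
Proof. by case: G_hahn => -[/set_mem]. Qed.

Let GD x y : G x -> G y -> G (x + y).
Proof.
case: G_hahn => -[_ GB] _ _ Gx Gy.
have GNy : G (0 - y) by apply/set_mem/GB; exact: mem_set.
by rewrite -[y]opprK -[- y]sub0r; apply/set_mem/GB; exact: mem_set.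
Qed.

(** Described by coordinates instead of values, the subgroups [C_c] are visibly
    closed under addition and decreasing in [c]. *)
Lemma principal_convexP c x :
  principal_convex G c x <-> G x /\ (forall b, (b < c)%O -> x b = 0).
Proof.
case: G_hahn => _ _ Gwo; split=> -[Gx]; have [->|/eqP x0] := eqVneq x 0.
- by [].
- have [a [-> _ lba]] := hahn_product_min (Gwo _ Gx) x0.
  move=> /= le_ca; split=> // b lt_bc; apply: contrapT => /lba le_ab.
  by move: (lt_le_trans lt_bc le_ca); rewrite ltNge le_ab.
- by split; rewrite ?hval0.
- have [a [va xa _]] := hahn_product_min (Gwo _ Gx) x0.
  by move=> x_lt; split=> //=; rewrite va /= leNgt; apply/negP => /x_lt.
Qed.

Lemma principal_convexW c x : principal_convex G c x -> G x.
Proof. by case. Qed.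

Lemma principal_convex0 c : principal_convex G c 0.
Proof. exact/principal_convexP. Qed.

Lemma principal_convexD c x y :
  principal_convex G c x -> principal_convex G c y -> principal_convex G c (x + y).
Proof.
move=> /principal_convexP[Gx xP] /principal_convexP[Gy yP].
apply/principal_convexP; split=> [|b lt_bc]; first exact: GD.
by rewrite -[LHS]/(x b + y b) xP // yP // addr0.
Qed.

Lemma principal_convexS a c x :
  (a <= c)%O -> principal_convex G c x -> principal_convex G a x.
Proof.
move=> le_ac /principal_convexP[Gx xP]; apply/principal_convexP; split=> // b.
by move=> lt_ba; apply/xP/(lt_le_trans lt_ba).
Qed.

Lemma hval_Some x :
  G x -> x <> 0 -> exists2 a, hval x = Some a & principal_convex G a x.
Proof.
case: G_hahn => _ _ Gwo Gx x0.
have [a [va _ _]] := hahn_product_min (Gwo _ Gx) x0.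
by exists a; rewrite // /principal_convex /= va /=.
Qed.

(** The base point [c0] only serves to exclude an empty [Gamma], for which there
    is no subgroup [C_c] at all. *)
Lemma principal_convex_cover (c0 : Gamma) x :
  G x -> exists c, principal_convex G c x.
Proof.
move=> Gx; have [->|/eqP x0] := eqVneq x 0.
  by exists c0; exact: principal_convex0.
by have [a _] := hval_Some Gx x0; exists a.
Qed.

Lemma principal_convex_cover2 (c0 : Gamma) x y : G x -> G y ->
  exists c, principal_convex G c x /\ principal_convex G c y.
Proof.
move=> /(principal_convex_cover c0)[a ax] /(principal_convex_cover c0)[b yb].
by have [le_ab|/ltW le_ba] := leP a b; [exists a | exists b]; split=> //;
  apply: principal_convexS; eassumption.
Qed.

(** * Restricting a lift to the principal convex subgroups *)

Lemma ordered_iso0 C D f : C 0 -> ordered_iso C D f -> f 0 = 0.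
Proof.
move=> C0 [_ fD _]; apply: (addrI (f 0)).
by rewrite -fD ?addr0 //; exact: mem_set.
Qed.

Context {tau : Gamma -> Gamma} (tau_aut : order_automorphism tau).

Lemma lift_principal_convex sigma : order_preserving_aut G sigma ->
  lifts_to G tau sigma -> forall c x, G x ->
  principal_convex G (tau c) (sigma x) <-> principal_convex G c x.
Proof.
move=> sigma_aut sigma_tau c x Gx; have [->|/eqP x0] := eqVneq x 0.
  rewrite (ordered_iso0 G0 sigma_aut); split=> _; exact: principal_convex0.
have Gsx : G (sigma x) by case: sigma_aut => -[sG _ _] _ _; exact: sG.
have [a va _] := hval_Some Gx x0.
rewrite /principal_convex /= (sigma_tau _ Gx x0) va /= (proj2 tau_aut).
by split=> -[].
Qed.

Lemma lift_restrict sigma : order_preserving_aut G sigma ->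
  lifts_to G tau sigma -> forall c,
  ordered_iso (principal_convex G c) (principal_convex G (tau c)) sigma.
Proof.
move=> sigma_aut sigma_tau c.
have sigmaC := lift_principal_convex sigma_aut sigma_tau c.
have [[_ sigma_inj sigma_surj] sigmaD sigma_pos] := sigma_aut.
have CG x : x \in principal_convex G c -> x \in G.
  by move=> /set_mem/principal_convexW/mem_set.
split; first split.
- by move=> x Cx; apply/sigmaC => //; exact: principal_convexW Cx.
- by move=> x y /CG Gx /CG Gy; exact: sigma_inj.
- move=> y Cy; have [x Gx xy] := sigma_surj y (principal_convexW Cy).
  by exists x => //; apply/sigmaC; rewrite ?xy.
- by move=> x y /CG Gx /CG Gy; exact: sigmaD.
- by move=> x /CG Gx; exact: sigma_pos.
Qed.

(** * Gluing compatible isomorphisms *)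

Context {sigma_ : Gamma -> fam_prod A -> fam_prod A}.
Hypothesis sigma_iso : forall c,
  ordered_iso (principal_convex G c) (principal_convex G (tau c)) (sigma_ c).
Hypothesis sigma_compat : forall c a, (a < c)%O ->
  forall x, principal_convex G c x -> sigma_ a x = sigma_ c x.

(** [sigma_] has no component at the value of [0], so [0] is sent to [0] by hand. *)
Definition glue x : fam_prod A := if hval x is Some a then sigma_ a x else 0.

Lemma local_iso0 c : sigma_ c 0 = 0.
Proof. exact: ordered_iso0 (principal_convex0 c) (sigma_iso c). Qed.

(** The argument may thus be viewed in any [C_c] containing it, which lets a single
    [sigma_ c] handle finitely many arguments at once. *)
Lemma glueE c x : principal_convex G c x -> glue x = sigma_ c x.
Proof.
move=> Cx; have [->|/eqP x0] := eqVneq x 0; first by rewrite /glue hval0 local_iso0.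
have [a va Cax] := hval_Some (principal_convexW Cx) x0.
rewrite /glue va; case: Cx => _ /=; rewrite va /= le_eqVlt.
by case/predU1P => [->//|lt_ca]; rewrite (sigma_compat lt_ca).
Qed.

(** Compatibility with the [sigma_ b], [b > c], is what forbids the value to jump:
    an image of value [tau b] comes from [C_b]. *)
Lemma local_iso_hval c x :
  G x -> hval x = Some c -> hval (sigma_ c x) = Some (tau c).
Proof.
move=> Gx vx; have [[tau' tau'K tauK] tau_mono] := tau_aut.
have Cx : principal_convex G c x by split; rewrite ?vx /=.
have [[sC s_inj _] _ _] := sigma_iso c.
have sx0 : sigma_ c x <> 0.
  rewrite -(local_iso0 c) => /s_inj x0; move: vx; rewrite x0 ?hval0 //.
    exact: mem_set.
  exact/mem_set/principal_convex0.
have [b vb Cb] := hval_Some (principal_convexW (sC _ Cx)) sx0.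
rewrite vb; congr Some; apply/eqP; rewrite eq_le.
have -> : (tau c <= b)%O by case: (sC _ Cx); rewrite vb.
rewrite andbT leNgt -[b]tauK (leW_mono tau_mono); apply/negP => lt_c.
rewrite -[b]tauK in Cb.
have [[_ _ s'_surj] _ _] := sigma_iso (tau' b).
have [y Cy syx] := s'_surj _ Cb.
suff eq_yx : y = x.
  by move: Cy; rewrite eq_yx => -[_]; rewrite vx /= leNgt lt_c.
apply: s_inj; try exact: mem_set.
  exact/mem_set/(principal_convexS (ltW lt_c)).
by rewrite (sigma_compat lt_c).
Qed.

Lemma glue_lifts : lifts_to G tau glue.
Proof.
move=> x Gx x0; have [a va Cx] := hval_Some Gx x0.
by rewrite (glueE Cx) (local_iso_hval Gx va) va.
Qed.

Lemma glue_aut_nonempty (c0 : Gamma) : order_preserving_aut G glue.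
Proof.
have [[tau' _ tauK] _] := tau_aut.
split; first split.
- move=> x /(principal_convex_cover c0)[c Cx]; rewrite (glueE Cx).
  by have [[sC _ _] _ _] := sigma_iso c; exact: principal_convexW (sC _ Cx).
- move=> x y /set_mem Gx /set_mem Gy.
  have [c [Cx Cy]] := principal_convex_cover2 c0 Gx Gy.
  rewrite (glueE Cx) (glueE Cy); have [[_ s_inj _] _ _] := sigma_iso c.
  by apply: s_inj; exact: mem_set.
- move=> y /(principal_convex_cover c0)[c Cy]; rewrite -[c]tauK in Cy.
  have [[_ _ s_surj] _ _] := sigma_iso (tau' c).
  have [x Cx <-] := s_surj _ Cy.
  by exists x; [exact: principal_convexW Cx | exact: glueE].
- move=> x y /set_mem Gx /set_mem Gy.
  have [c [Cx Cy]] := principal_convex_cover2 c0 Gx Gy.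
  rewrite (glueE Cx) (glueE Cy) (glueE (principal_convexD Cx Cy)).
  by have [_ sD _] := sigma_iso c; apply: sD; exact: mem_set.
- move=> x /set_mem/(principal_convex_cover c0)[c Cx]; rewrite (glueE Cx).
  by have [_ _ s_pos] := sigma_iso c; apply: s_pos; exact: mem_set.
Qed.

Lemma glue_aut : order_preserving_aut G glue.
Proof.
have [[c0]|Gamma0] := pselect (inhabited Gamma); first exact: glue_aut_nonempty.
have triv x y : x = y.
  by apply: functional_extensionality_dep => a; case: Gamma0; exists.
split; first split.
- by move=> x; rewrite (triv (glue x) x).
- by move=> x y _ _ _; exact: triv.
- by move=> y Gy; exists y.
- by move=> x y _ _; exact: triv.
- by move=> x _; rewrite (triv (glue x) x).
Qed.

End HahnGroupAutomorphisms.

Theorem theorem3p7 (d : Order.disp_t) (Gamma : orderType d)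
    (A : Gamma -> porderZmodType)
    (A_arch : forall gamma : Gamma, archimedean_ordered_group (A gamma))
    (G : set (fam_prod A)) (G_hahn : is_hahn_group G)
    (tau : Gamma -> Gamma) (tau_aut : order_automorphism tau) :
  (exists sigma : fam_prod A -> fam_prod A,
     order_preserving_aut G sigma /\ lifts_to G tau sigma)
  <->
  (exists sigma_ : Gamma -> fam_prod A -> fam_prod A,
     (forall gamma : Gamma,
        ordered_iso (principal_convex G gamma) (principal_convex G (tau gamma))
                    (sigma_ gamma)) /\
     (forall gamma delta : Gamma, (delta < gamma)%O ->
        forall x : fam_prod A, principal_convex G gamma x ->
          sigma_ delta x = sigma_ gamma x)).
Proof.
split=> [[sigma [sigma_aut sigma_tau]]|[sigma_ [sigma_iso sigma_compat]]].
  by exists (fun=> sigma); split=> // c; exact: lift_restrict.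
exists (glue (sigma_ := sigma_)); split.
  exact (glue_aut G_hahn tau_aut sigma_iso sigma_compat).
exact (glue_lifts G_hahn tau_aut sigma_iso sigma_compat).
Qed.
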